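(* Let $b\ge 2$, let $u\in U_{2,b}^E$, and set $d=\gcd(2,b-1)$. Then there exist arbitrarily long finite $d$-consecutive sequences of $u$-attracted numbers for $E_{2,b}$; that is, for every $L\in\mathbb{Z}^+$ there is an arithmetic sequence of $L$ positive integers with constant difference $d$, all of whose terms are $u$-attracted numbers for $E_{2,b}$.
   Context: For a base $b\ge 2$, every $a\in\mathbb{Z}^+$ has a base $b$ expansion $a=\sum_{i=0}^n a_ib^i$ with $0\le a_i<b$ and leading digit $a_n\ne 0$. The $b$-elated function $E_{2,b}:\mathbb{Z}^+\to\mathbb{Z}^+$ is defined by $E_{2,b}(a)=a_n\sum_{i=0}^n a_i^2$. Powers $E_{2,b}^k$ denote iteration. $U_{2,b}^E=\{a\in\mathbb{Z}^+ \mid E_{2,b}^m(a)=a \text{ for some } m\in\mathbb{Z}^+\}$ is the set of all numbers in cycles of $E_{2,b}$. For $u\in U_{2,b}^E$, a number $a\in\mathbb{Z}^+$ is a $u$-attracted number for $E_{2,b}$ if $E_{2,b}^k(a)=u$ for some $k\in\mathbb{Z}^+$. A $d$-consecutive sequence is an arithmetic sequence with constant difference $d$. *)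

(* Defs.v *)
From mathcomp Require Import all_boot.

Set Implicit Arguments.
Unset Strict Implicit.
Unset Printing Implicit Defensive.

(* Coefficient of b ^ i in the base b expansion of a; for a > 0 the leading
   index is trunc_log b a (the largest n with b ^ n <= a). *)
Definition digit (b a i : nat) : nat := (a %/ b ^ i) %% b.

(* Positive integers are represented by nat together with explicit positivity
   hypotheses; the junk value at 0 is elated b 0 = 0. *)
Definition elated (b a : nat) : nat :=
  let n := trunc_log b a in
  digit b a n * \sum_(i < n.+1) digit b a i ^ 2.

Definition elated_cyclic (b u : nat) : Prop :=
  0 < u /\ exists2 m, 0 < m & iter m (elated b) u = u.

Definition elated_attracted (b u a : nat) : Prop :=
  0 < a /\ exists2 k, 0 < k & iter k (elated b) a = u.

Definition d_consecutive (d : nat) (s : seq nat) : Prop :=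
  forall i, i.+1 < size s -> nth 0 s i.+1 = nth 0 s i + d.

Lemma sum_digits_lt (b n : nat) (c : nat -> nat) :
  1 < b -> (forall i, c i < b) -> \sum_(i < n) c i * b ^ i < b ^ n.
Proof.
move=> b1 cb; elim: n => [|n IH]; first by rewrite big_ord0.
rewrite big_ord_recr /= expnS.
apply: (@leq_trans ((c n).+1 * b ^ n)); first by rewrite mulSn ltn_add2r.
by rewrite leq_mul2r cb orbT.
Qed.

Lemma digit_sum (b n : nat) (c : nat -> nat) (i : nat) :
  1 < b -> (forall i, c i < b) -> i < n ->
  digit b (\sum_(j < n) c j * b ^ j) i = c i.
Proof.
move=> b1 cb; elim: n c cb i => // n IH c cb i lt_in.
have b0 : 0 < b by apply: ltnW.
have -> : \sum_(j < n.+1) c j * b ^ j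
          = c 0 + b * \sum_(j < n) c j.+1 * b ^ j.
  rewrite big_ord_recl /= muln1 big_distrr /=; congr (_ + _).
  by apply: eq_bigr => j _; rewrite expnS mulnCA.
case: i lt_in => [|i] lt_in.
  by rewrite /digit divn1 mulnC addnC modnMDl modn_small.
rewrite /digit expnS divnMA.
rewrite [b * _]mulnC [c 0 + _]addnC divnMDl // (divn_small (cb 0)) addn0.
exact: IH (fun j => c j.+1) (fun j => cb j.+1) i lt_in.
Qed.

Lemma trunc_log_sum (b n : nat) (c : nat -> nat) :
  1 < b -> (forall i, c i < b) -> 0 < c n ->
  trunc_log b (\sum_(i < n.+1) c i * b ^ i) = n.
Proof.
move=> b1 cb cn; apply: trunc_log_eq => //; apply/andP; split.
  rewrite big_ord_recr /=; apply: leq_trans (leq_addl _ _).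
  exact: leq_pmull.
exact: sum_digits_lt.
Qed.

Theorem elatedE (b n : nat) (c : nat -> nat) :
  1 < b -> (forall i, c i < b) -> 0 < c n ->
  elated b (\sum_(i < n.+1) c i * b ^ i) = c n * \sum_(i < n.+1) c i ^ 2.
Proof.
move=> b1 cb cn; rewrite /elated trunc_log_sum // digit_sum //.
by congr (_ * _); apply: eq_bigr => i _; rewrite digit_sum.
Qed.

Theorem digit_expansion (b a : nat) : 1 < b -> 0 < a ->
  [/\ a = \sum_(i < (trunc_log b a).+1) digit b a i * b ^ i,
      forall i, digit b a i < b
    & 0 < digit b a (trunc_log b a)].
Proof.
move=> b1 a0; have b0 : 0 < b by apply: ltnW.
have /andP[le_a lt_a] := trunc_log_bounds b1 a0.
have H n : a = \sum_(i < n) digit b a i * b ^ i + a %/ b ^ n * b ^ n.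
  elim: n => [|n IH]; first by rewrite big_ord0 divn1 muln1.
  rewrite big_ord_recr /= -addnA {1}IH; congr (_ + _).
  rewrite {1}(divn_eq (a %/ b ^ n) b) mulnDl -divnMA -expnSr addnC.
  by rewrite -mulnA -expnS.
split.
- by rewrite {1}(H (trunc_log b a).+1) (divn_small lt_a) addn0.
- by move=> i; rewrite ltn_pmod.
- rewrite /digit modn_small ?divn_gt0 ?expn_gt0 ?b0 //.
  by rewrite ltn_divLR ?expn_gt0 ?b0 // -expnS.
Qed.

(* Main.v *)
Require Import Defs.
From mathcomp Require Import all_boot.
From mathcomp Require Import zify.

(** Write [E] for [elated b] and [S] for the sum of the squares of the base [b]
    digits.  Putting zeros and then some digits 1 in front of [x] adds the
    number of these digits to [S x] and makes the leading digit 1, so for every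
    [m > 0] one translation of [x], the same for all [x] below a given bound,
    has the image [S x + m] under [E] ([elated_prepend]).  Hence every
    positive [u] is the image of arbitrarily large numbers.

    Call a finite list jointly [u]-attracted if a common translation followed
    by a common number of steps of [E] sends all its entries to [u].  A
    singleton is.  By prepending ones, a list is jointly attracted as soon as
    the list of the [S (t + n) + 1], for some fixed [n], is
    ([jointly_attracted_pullback]).  So it suffices to merge two entries by
    such maps, and this shortens the list:
    - if two numbers differ by [(b - 1) * v], translate them to [v] and [b * v],
      which have the same nonzero digits ([merge_of_congruent]);
    - otherwise, force a carry from the lower into the upper number at a digit
      [c]: the values of [S] then differ by [2 * c + 1] minus a constant, and a
      suitable [c] makes them congruent modulo [b - 1] ([congruent_of_parity]),
      which leads to the first case.
    For odd [b] the second step has a parity condition: the numbers must have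
    the same parity.  The map [S] preserves parity in that case, so the
    condition survives all the steps, and it holds for the multiples of
    [gcdn 2 (b - 1)], whose translates form the required sequence. *)

(** * Sums of squares of digits *)

(** The number [a] itself bounds the number of its digits, as [a < b ^ a]; the
    bound is immaterial by [digit_sqsumE]. *)
Definition digit_sqsum (b a : nat) : nat := \sum_(i < a) digit b a i ^ 2.

(** The joint translation and the joint number of steps are what lets the
    property pass from a list of images back to the list. *)
Definition jointly_attracted (b u : nat) (s : seq nat) : Prop :=
  exists n k, 0 < k /\ forall t, t \in s -> iter k (elated b) (t + n) = u.

Section FixedBase.

Variable b : nat.
Hypothesis b_gt1 : 1 < b.

Local Notation E := (elated b).
Local Notation S := (digit_sqsum b).

Let b_gt0 : 0 < b. Proof. exact: ltnW. Qed.

Lemma digit_above a N i : a < b ^ N -> N <= i -> digit b a i = 0.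
Proof.
move=> aN Ni; rewrite /digit divn_small ?mod0n //.
by apply: leq_trans aN _; rewrite leq_exp2l.
Qed.

Lemma sum_digit_sqr_widen a N M : a < b ^ N -> N <= M ->
  \sum_(i < M) digit b a i ^ 2 = \sum_(i < N) digit b a i ^ 2.
Proof.
move=> aN NM; rewrite -(subnKC NM) big_split_ord /=.
rewrite [X in _ + X]big1 ?addn0 // => i _.
by rewrite (digit_above _ _ _ aN) ?leq_addr.
Qed.

Lemma digit_sqsumE a N : a < b ^ N -> S a = \sum_(i < N) digit b a i ^ 2.
Proof.
move=> aN; have aa : a < b ^ a by exact: ltn_expl.
rewrite /digit_sqsum -(sum_digit_sqr_widen _ _ (maxn a N) aa) ?leq_maxl //.
by rewrite (sum_digit_sqr_widen _ _ _ aN) ?leq_maxr.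
Qed.

Lemma digit_sqsum0 : S 0 = 0.
Proof. by rewrite /digit_sqsum big_ord0. Qed.

Lemma digit_sqsum_small c : c < b -> S c = c ^ 2.
Proof.
move=> cb; rewrite (digit_sqsumE _ 1) ?expn1 // big_ord1.
by rewrite /digit divn1 modn_small.
Qed.

Lemma digit_low x y r i : i < r -> digit b (x + b ^ r * y) i = digit b x i.
Proof.
move=> ir; rewrite /digit addnC.
have -> : b ^ r * y = b ^ (r - i.+1) * y * b * b ^ i.
  by rewrite -mulnA -expnS mulnAC -expnD subnK.
by rewrite divnMDl ?expn_gt0 ?b_gt0 // modnMDl.
Qed.

Lemma digit_high x y r i : x < b ^ r ->
  digit b (x + b ^ r * y) (r + i) = digit b y i.
Proof.
move=> xr; rewrite /digit expnD divnMA addnC mulnC.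
by rewrite divnMDl ?expn_gt0 ?b_gt0 // (divn_small xr) addn0.
Qed.

Lemma digit_sqsum_cat x y r : x < b ^ r -> S (x + b ^ r * y) = S x + S y.
Proof.
move=> xr; have yy : y < b ^ y by exact: ltn_expl.
have lt : x + b ^ r * y < b ^ (r + y).
  apply: (@leq_trans (b ^ r * y.+1)); first by rewrite mulnS ltn_add2r.
  by rewrite expnD leq_mul2l yy orbT.
rewrite (digit_sqsumE _ _ lt) big_split_ord /= (digit_sqsumE _ _ xr).
congr (_ + _); apply: eq_bigr => i _; first by rewrite digit_low.
by rewrite digit_high.
Qed.

Lemma digit_sqsum_lead1 x r : x < b ^ r -> S (x + b ^ r) = (S x).+1.
Proof.
move=> xr; rewrite -[b ^ r]muln1 digit_sqsum_cat //.
by rewrite (digit_sqsum_small 1) // addn1.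
Qed.

Lemma elated_lead1 x r : x < b ^ r -> E (x + b ^ r) = (S x).+1.
Proof.
move=> xr; have lt : x + b ^ r < b ^ r.+1.
  apply: (@leq_trans (2 * b ^ r)); first by rewrite mul2n -addnn ltn_add2r.
  by rewrite expnS leq_mul2r b_gt1 orbT.
have tl : trunc_log b (x + b ^ r) = r.
  by apply: trunc_log_eq => //; rewrite leq_addl.
rewrite /elated tl -digit_sqsumE // digit_sqsum_lead1 //.
have -> : digit b (x + b ^ r) r = 1.
  rewrite -{1}[b ^ r]muln1 -[X in digit _ _ X]addn0 digit_high //.
  by rewrite /digit divn1 modn_small.
by rewrite mul1n.
Qed.

Lemma odd_digit_sqsum a : odd b -> odd (S a) = odd a.
Proof.
move=> ob; elim/ltn_ind: a => a IH.
have [->|a0] := posnP a; first by rewrite digit_sqsum0.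
have ea : a = a %% b + b ^ 1 * (a %/ b).
  by rewrite {1}(divn_eq a b) addnC mulnC expn1.
rewrite {1}ea digit_sqsum_cat ?expn1 ?ltn_pmod // digit_sqsum_small ?ltn_pmod //.
rewrite oddD oddX /= IH ?ltn_Pdiv // [in RHS]ea oddD oddM expn1 ob //.
Qed.

(** * Prepending ones *)

Lemma digit_sqsum_prepend N m : exists M n, N <= M /\
  forall x, x < b ^ N -> x + n < b ^ M /\ S (x + n) = S x + m.
Proof.
elim: m => [|m [M [n [NM H]]]].
  by exists N, 0; split=> // x xN; rewrite !addn0.
exists M.+1, (n + b ^ M); split; first exact: leqW.
move=> x /H [lt eqS]; rewrite addnA digit_sqsum_lead1 // eqS addnS.
split=> //; apply: (@leq_trans (2 * b ^ M)).
  by rewrite mul2n -addnn ltn_add2r.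
by rewrite expnS leq_mul2r b_gt1 orbT.
Qed.

(** The last digit prepended is the leading digit 1, by which [E] multiplies. *)
Lemma elated_prepend N m : exists2 n, b ^ N <= n &
  forall x, x < b ^ N -> E (x + n) = S x + m.+1.
Proof.
have [M [n [NM H]]] := digit_sqsum_prepend N m.
exists (n + b ^ M).
  by apply: leq_trans (leq_addl _ _); rewrite leq_exp2l.
by move=> x /H [lt eqS]; rewrite addnA elated_lead1 // eqS addnS.
Qed.

Lemma jointly_attracted1 u t : 0 < u -> jointly_attracted b u [:: t].
Proof.
move=> u0; have [n len H] := elated_prepend t u.-1.
have tn : t <= n by apply: leq_trans len; apply/ltnW/ltn_expl.
exists (n - t), 1; split=> // x; rewrite inE => /eqP -> /=.
rewrite subnKC // -[n]add0n H ?expn_gt0 ?b_gt0 //.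
by rewrite digit_sqsum0 add0n prednK.
Qed.

(** The translation by [n2] of the images is absorbed into the digits: it is
    realized by [n2] further ones in front of the numbers [t + n]. *)
Lemma jointly_attracted_pullback u n s :
  jointly_attracted b u [seq (S (t + n)).+1 | t <- s] ->
  jointly_attracted b u s.
Proof.
move=> [n2 [k [k0 H]]].
pose N := \max_(t <- s) (t + n).
have [n3 _ H3] := elated_prepend N n2.
exists (n + n3), k.+1; split=> // t ts.
have tN : t + n < b ^ N.
  by apply: leq_ltn_trans (ltn_expl _ b_gt1); exact: leq_bigmax_seq.
rewrite iterSr addnA H3 // addnS -addSn.
by apply: H; apply: map_f ts.
Qed.

(** * Merging two numbers *)

(** Only the difference of two numbers matters for what a common translation
    can do to them; a distant leading 1 makes room for the translation. *)
Lemma digit_sqsum_translate t d x : exists n,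
  S (t + n) = (S x).+1 /\ S (t + d + n) = (S (x + d)).+1.
Proof.
pose R := t + x + d.
have RR : R < b ^ R by exact: ltn_expl.
exists (x + b ^ R - t).
have -> : t + (x + b ^ R - t) = x + b ^ R by lia.
have -> : t + d + (x + b ^ R - t) = x + d + b ^ R by lia.
by rewrite !digit_sqsum_lead1 //; lia.
Qed.

(** If the numbers differ by [(b - 1) * v], a translation takes them to [v] and
    [b * v], up to a common leading 1; multiplying by [b] appends a zero. *)
Lemma merge_of_congruent t1 t2 : t1 = t2 %[mod b.-1] ->
  exists n, S (t1 + n) = S (t2 + n).
Proof.
wlog le12 : t1 t2 / t1 <= t2.
  move=> W; have [/W//|/ltnW le21 /esym eq12] := leqP t1 t2.
  by have [n en] := W _ _ le21 eq12; exists n.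
move/esym/eqP; rewrite eqn_mod_dvd // => /dvdnP [v ev].
have [n [e1 e2]] := digit_sqsum_translate t1 (t2 - t1) v.
exists n; rewrite e1 -(subnKC le12) e2 ev.
have -> : v + v * b.-1 = 0 + b ^ 1 * v.
  by rewrite -mulnS prednK // expn1 mulnC.
by rewrite digit_sqsum_cat ?expn1 // digit_sqsum0.
Qed.

Lemma solve_double_succ_mod m s : 0 < m -> odd m || odd s ->
  exists2 c, c < m & (c * 2).+1 = s %[mod m].
Proof.
move=> m0 oms; pose s' := s + ~~ odd s * m.
have os : odd s'.
  by rewrite /s' oddD oddM; case: (odd s) oms => //=; rewrite orbF => ->.
exists (s'./2 %% m); first by rewrite ltn_pmod.
rewrite -addn1 -modnDml modnMml modnDml muln2 addn1.
have -> : s'./2.*2.+1 = s' by lia.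
by rewrite /s' addnC modnMDl.
Qed.

(** For [d = t2 - t1 > 0] and [d < b ^ r], adding [d] to
    [c * b ^ r + (b ^ r - d)] clears the lower part and turns the digit [c]
    into [c + 1].  As [c] runs over the [b - 1] digits for which this causes no
    further carry, it runs over all residues modulo [b - 1].  The equation for
    [c] is [2 * c + 1 = S (b ^ r - d)] modulo [b - 1]; for odd [b] the modulus is
    even, and the right-hand side is odd because [d] is even. *)
Lemma congruent_of_parity t1 t2 : (odd b -> odd t1 = odd t2) ->
  exists n, S (t1 + n) = S (t2 + n) %[mod b.-1].
Proof.
wlog lt12 : t1 t2 / t1 < t2.
  move=> W par; have [lt|lt|->] := ltngtP t1 t2; first exact: W lt par.
  - have par' : odd b -> odd t2 = odd t1 by move=> /par.
    by have [n en] := W _ _ lt par'; exists n.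
  - by exists 0.
move=> par; set d := t2 - t1; set r := d; set x := b ^ r - d.
have dr : d < b ^ r by exact: ltn_expl.
have xr : x < b ^ r by rewrite /x; lia.
have oS : odd b.-1 || odd (S x).
  have ob : odd b.-1 = ~~ odd b by rewrite -[in RHS](prednK b_gt0) /= negbK.
  rewrite ob; case: (boolP (odd b)) => //= ob1.
  have od : ~~ odd d by rewrite oddB ?(ltnW lt12) // (par ob1) addbb.
  by rewrite odd_digit_sqsum // oddB ?(ltnW dr) // oddX ob1 orbT (negbTE od).
have b1 : 0 < b.-1 by lia.
have [c cb ec] := solve_double_succ_mod _ _ b1 oS.
have [n [e1 e2]] := digit_sqsum_translate t1 d (x + b ^ r * c).
exists n; rewrite e1 -(subnKC (ltnW lt12)) e2.
have -> : x + b ^ r * c + d = 0 + b ^ r * c.+1 by rewrite mulnS /x; lia.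
rewrite !digit_sqsum_cat ?expn_gt0 ?b_gt0 // digit_sqsum0.
have c1b : c.+1 < b by lia.
rewrite (digit_sqsum_small _ c1b) (digit_sqsum_small _ (ltnW c1b)).
rewrite -addnS -modnDml -ec modnDml; congr (_ %% _).
by rewrite -!mulnn; lia.
Qed.

(** * Finite lists *)

(** Two maps [t |-> S (t + n) + 1] merge the first two entries: after the first
    they are congruent modulo [b - 1], after the second they are equal. *)
Lemma jointly_attracted_of_parity u s : 0 < u ->
  {in s &, forall x y, odd b -> odd x = odd y} -> jointly_attracted b u s.
Proof.
move=> u0; have [m] := ubnP (size s); elim: m s => // m IH.
case=> [|t1 [|t2 s]] /=; first by exists 0, 1.
  by move=> *; exact: jointly_attracted1.
rewrite ltnS => sz par.
have [n1 en1] : exists n, S (t1 + n) = S (t2 + n) %[mod b.-1].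
  by apply: congruent_of_parity; apply: par; rewrite !inE eqxx ?orbT.
have [n2 en2] :
    exists n, S ((S (t1 + n1)).+1 + n) = S ((S (t2 + n1)).+1 + n).
  apply: merge_of_congruent.
  by rewrite -(addn1 (S (t1 + n1))) -modnDml en1 modnDml addn1.
apply: (jointly_attracted_pullback _ n1).
apply: (jointly_attracted_pullback _ n2).
rewrite -map_comp; set f := _ \o _.
have ef : f t1 = f t2 by rewrite /f /= en2.
have [n [k [k0 H]]] : jointly_attracted b u (map f (t2 :: s)).
  apply: IH; first by rewrite size_map.
  move=> _ _ /mapP [x xs ->] /mapP [y ys ->] ob; rewrite /f /=.
  rewrite !odd_digit_sqsum // !oddD /= !odd_digit_sqsum // !oddD.
  by rewrite (par x y) // inE ?xs ?ys orbT.
exists n, k; split=> // t; rewrite map_cons inE => /orP [/eqP ->|]; last exact: H.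
by rewrite ef; apply: H; rewrite inE eqxx.
Qed.

End FixedBase.

Theorem theorem8 (b u : nat) (hb : 2 <= b) (hu : elated_cyclic b u) :
  forall L : nat, 0 < L ->
    exists s : seq nat,
      [/\ size s = L,
          d_consecutive (gcdn 2 (b - 1)) s
        & forall a : nat, a \in s -> elated_attracted b u a].
Proof.
move=> L _; case: hu => u0 _; set d := gcdn 2 (b - 1).
have d0 : 0 < d by rewrite gcdn_gt0.
pose s0 := [seq i.+1 * d | i <- iota 0 L].
have [n [k [k0 H]]] : jointly_attracted b u s0.
  apply: jointly_attracted_of_parity => // _ _ /mapP [i _ ->] /mapP [j _ ->] ob.
  have -> : d = 2 by apply/gcdn_idPl; rewrite dvdn2 oddB ?ob // ltnW.
  by rewrite !oddM !andbF.
exists [seq t + n | t <- s0]; split; first by rewrite !size_map size_iota.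
- move=> i; rewrite !size_map size_iota => iL.
  have nthE j : j < L -> nth 0 [seq t + n | t <- s0] j = j.+1 * d + n.
    move=> jL; rewrite (nth_map 0) ?size_map ?size_iota //.
    by rewrite (nth_map 0) ?size_iota // nth_iota.
  by rewrite !nthE ?(ltnW iL) // [in LHS]mulSn; lia.
- move=> _ /mapP [t ts ->]; split; last by exists k => //; exact: H.
  by case/mapP: ts => i _ ->; rewrite mulSn; lia.
Qed.
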